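(* Let $X$ be a finite alphabet with $|X|=N$, each symbol being of type GEN (acts on $\{0,1\}$ as the constant map $1$), PROP (acts as the identity) or KILL (acts as the constant map $0$), with $g,t,k$ the respective numbers of symbols, and $\mathfrak{d}=gt$. Let $a(L)$ be the number of cascade-free sequences in $X^L$. If $\mathfrak{d}>0$, then for all $L\ge 0$ \[a(L)=(\sqrt{\mathfrak{d}})^L\,U_L(x),\qquad x=\frac{N}{2\sqrt{\mathfrak{d}}},\] where $U_L$ is the Chebyshev polynomial of the second kind. Moreover $x\ge 1$, with equality if and only if $k=0$ and $g=t=N/2$.
   Context: For $x_1,\dots,x_L\in X^L$ define $\sigma_0=0$ and $\sigma_j=T_{x_j}(\sigma_{j-1})$, where $T_x$ is the map by which $x$ acts. The sequence is cascade-free if no $j$ has $x_j\in$ PROP and $\sigma_{j-1}=1$. Chebyshev polynomials of the second kind: $U_0(x)=1$, $U_1(x)=2x$, $U_n(x)=2xU_{n-1}(x)-U_{n-2}(x)$. *)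

(* Defs.v *)
From HB Require Import structures.
From mathcomp Require Import all_boot all_order all_algebra.

Set Implicit Arguments.
Unset Strict Implicit.
Unset Printing Implicit Defensive.

Import GRing.Theory Num.Theory.
Local Open Scope ring_scope.

Inductive symtype := GEN | PROP | KILL.

Definition symtype_code (y : symtype) : 'I_3 :=
  match y with
  | GEN => inord 0
  | PROP => inord 1
  | KILL => inord 2
  end.

Definition symtype_decode (i : 'I_3) : symtype :=
  match val i with
  | 0%N => GEN
  | 1%N => PROP
  | _ => KILL
  end.

Lemma symtype_codeK : cancel symtype_code symtype_decode.
Proof. by case; rewrite /symtype_decode /= inordK. Qed.

HB.instance Definition _ := Finite.copy symtype (can_type symtype_codeK).

(* The state set {0,1} is bool, with 0 = false and 1 = true. *)
Definition act (y : symtype) : bool -> bool :=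
  match y with
  | GEN => fun=> true
  | PROP => id
  | KILL => fun=> false
  end.

Section CascadeFree.

Variables (X : finType) (ty : X -> symtype).

Definition nsym (y : symtype) : nat := #|[set x : X | ty x == y]|.

Definition sigma (L : nat) (s : L.-tuple X) (j : nat) : bool :=
  foldl (fun b x => act (ty x) b) false (take j s).

Lemma sigma0 L (s : L.-tuple X) : sigma s 0 = false.
Proof. by rewrite /sigma take0. Qed.

Lemma sigmaS L (s : L.-tuple X) (j : 'I_L) :
  sigma s j.+1 = act (ty (tnth s j)) (sigma s j).
Proof.
rewrite /sigma (take_nth (tnth s j)) ?size_tuple // -cats1 foldl_cat /=.
by rewrite -tnth_nth.
Qed.

(* Tuples are indexed from 0: tnth s j is x_(j+1), and sigma s j is the state
   just before it is read. *)
Definition cascade_free (L : nat) (s : L.-tuple X) : bool :=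
  ~~ [exists j : 'I_L, (ty (tnth s j) == PROP) && (sigma s j == true)].

Definition num_cascade_free (L : nat) : nat :=
  #|[set s : L.-tuple X | cascade_free s]|.

End CascadeFree.

Fixpoint chebyshevU (R : nzRingType) (n : nat) {struct n} : {poly R} :=
  match n with
  | 0 => 1
  | 1 => 2%:R *: 'X
  | (n'.+1 as m).+1 => 2%:R *: 'X * chebyshevU R m - chebyshevU R n'
  end.

(* Main.v *)
(* Count the cascade-free words from either initial state: let A_b(L) be the
   number of words of length L with no PROP read in state 1 when started in
   state b.  Splitting off the first symbol,
     A_0(L+1) = g A_1(L) + (t + k) A_0(L),  A_1(L+1) = g A_1(L) + k A_0(L),
   so A_1(L+1) = A_0(L+1) - t A_0(L), and eliminating A_1 gives
   A_0(L+2) = N A_0(L+1) - g t A_0(L), the Chebyshev recurrence rescaled by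
   sqrt(g t).  The bound on x is AM-GM: N >= g + t >= 2 sqrt(g t). *)
Require Import Defs.
From HB Require Import structures.
From mathcomp Require Import all_boot all_order all_algebra.
From mathcomp Require Import zify ring lra.

Set Implicit Arguments.
Unset Strict Implicit.
Unset Printing Implicit Defensive.

Import Order.TTheory GRing.Theory Num.Theory.
Local Open Scope ring_scope.

(** Consing is a bijection from pairs (symbol, shorter tuple), inverted by [thead] and [behead]. *)
Lemma big_tuple_cons (R : Type) (idx : R) (op : Monoid.com_law idx)
    (X : finType) (L : nat) (F : L.+1.-tuple X -> R) :
  \big[op/idx]_(s : L.+1.-tuple X) F s =
  \big[op/idx]_(x : X) \big[op/idx]_(s : L.-tuple X) F [tuple of x :: s].
Proof.
rewrite pair_big /=.
rewrite (reindex (fun p : X * L.-tuple X => [tuple of p.1 :: p.2])) //=.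
exists (fun s : L.+1.-tuple X => (thead s, [tuple of behead s])) => [[x s] _|s _] /=.
  by congr pair; apply: val_inj.
by rewrite [RHS]tuple_eta.
Qed.

(* The equality test on symtype is transported from 'I_3 along inord and does
   not reduce. *)
Lemma symtype_eqE (y z : symtype) :
  (y == z) =
  match y, z with
  | GEN, GEN | PROP, PROP | KILL, KILL => true
  | _, _ => false
  end.
Proof. by apply/eqP/idP; case: y; case: z. Qed.

Section CascadeFreeFrom.

Variables (X : finType) (ty : X -> symtype).

(** The initial state is a parameter because removing the first symbol may leave a word that starts
    in state 1. *)
Fixpoint cascade_free_from (b : bool) (s : seq X) : bool :=
  if s is x :: s' then
    ~~ ((ty x == PROP) && b) && cascade_free_from (act (ty x) b) s'
  else true.

Lemma cascade_free_fromP (x0 : X) (b : bool) (s : seq X) :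
  reflect (forall j : nat, (j < size s)%N ->
             ~~ ((ty (nth x0 s j) == PROP) &&
                 foldl (fun b x => act (ty x) b) b (take j s)))
          (cascade_free_from b s).
Proof.
elim: s b => [|x s IHs] b /=; first exact: ReflectT.
apply: (iffP andP) => [[h0 /IHs h] [|j] //= lt_js|h]; first exact: h.
split; first exact: (h 0%N).
by apply/IHs => j lt_js; apply: (h j.+1).
Qed.

Lemma cascade_freeE (L : nat) (s : L.-tuple X) :
  cascade_free ty s = cascade_free_from false s.
Proof.
(* The default for [nth] is taken from the word itself, so the empty word is treated apart. *)
case: L s => [|L] s; first by rewrite tuple0; apply/existsPn => -[].
pose x0 := thead s.
apply/existsPn/(cascade_free_fromP x0) => [h j|h j].
  rewrite size_tuple => lt_jL.
  by have := h (Ordinal lt_jL); rewrite (tnth_nth x0) eqb_id.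
by rewrite (tnth_nth x0) eqb_id; apply: h; rewrite size_tuple.
Qed.

Definition num_cascade_free_from (b : bool) (L : nat) : nat :=
  \sum_(s : L.-tuple X) cascade_free_from b s.

Lemma num_cascade_freeE (L : nat) :
  num_cascade_free ty L = num_cascade_free_from false L.
Proof.
rewrite /num_cascade_free -sum1dep_card big_mkcond.
by apply: eq_bigr => s _; rewrite cascade_freeE; case: cascade_free_from.
Qed.

Lemma sum_symtype (F : symtype -> nat) :
  (\sum_x F (ty x) =
   nsym ty GEN * F GEN + nsym ty PROP * F PROP + nsym ty KILL * F KILL)%N.
Proof.
rewrite /nsym -!sum1dep_card !big_distrl /= 3!(big_mkcond (fun _ => _ == _)).
by rewrite -!big_split; apply: eq_bigr => x _ /=; rewrite !symtype_eqE; case: (ty x); lia.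
Qed.

Lemma card_symtype : #|X| = (nsym ty GEN + nsym ty PROP + nsym ty KILL)%N.
Proof. by rewrite -sum1_card (sum_symtype (fun=> 1%N)) !muln1. Qed.

Lemma num_cascade_free_from0 (b : bool) : num_cascade_free_from b 0 = 1%N.
Proof.
rewrite /num_cascade_free_from (eq_bigr (fun=> 1%N)) => [|s _]; last by rewrite tuple0.
by rewrite sum1_card card_tuple expn0.
Qed.

(** After GEN the state is 1, after KILL it is 0. PROP is allowed only in state 0, which it
    preserves; hence the factor [~~ b]. *)
Lemma num_cascade_free_fromS (b : bool) (L : nat) :
  num_cascade_free_from b L.+1 =
  (nsym ty GEN * num_cascade_free_from true L
   + nsym ty PROP * (~~ b * num_cascade_free_from false L)
   + nsym ty KILL * num_cascade_free_from false L)%N.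
Proof.
rewrite /num_cascade_free_from big_tuple_cons /=.
rewrite (sum_symtype (fun y => \sum_(s : L.-tuple X)
  ~~ ((y == PROP) && b) && cascade_free_from (act y b) s)%N) /=.
by rewrite !symtype_eqE; case: b; rewrite /= ?mul1n // big1_eq.
Qed.

(* Stated without subtraction: A_0(L+2) = N A_0(L+1) - g t A_0(L). *)
Lemma num_cascade_free_rec (L : nat) :
  (num_cascade_free ty L.+2 + nsym ty GEN * nsym ty PROP * num_cascade_free ty L =
   #|X| * num_cascade_free ty L.+1)%N.
Proof.
(* Once everything is reduced to length [L], both sides are polynomials in g, t, k, A_0(L) and
   A_1(L). *)
rewrite !num_cascade_freeE card_symtype (num_cascade_free_fromS false L.+1).
rewrite (num_cascade_free_fromS true L) (num_cascade_free_fromS false L) /=.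
by rewrite !mul1n mul0n muln0; ring.
Qed.

End CascadeFreeFrom.

Lemma chebyshevU_recE (R : comNzRingType) (n : nat) (x : R) :
  (chebyshevU R n.+2).[x] =
  2%:R * x * (chebyshevU R n.+1).[x] - (chebyshevU R n).[x].
Proof.
rewrite [chebyshevU R n.+2]/(2%:R *: 'X * chebyshevU R n.+1 - chebyshevU R n).
by rewrite hornerD hornerN hornerM hornerZ hornerX.
Qed.

Theorem theorem4p1 (R : rcfType) (X : finType) (ty : X -> symtype)
    (N g t k d : nat) (x : R)
    (hN : #|X| = N)
    (hg : nsym ty GEN = g) (ht : nsym ty PROP = t) (hk : nsym ty KILL = k)
    (hd : d = (g * t)%N)
    (hx : x = N%:R / (2%:R * Num.sqrt d%:R))
    (d_gt0 : (0 < d)%N) :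
  (forall L : nat,
     (num_cascade_free ty L)%:R = Num.sqrt d%:R ^+ L * (chebyshevU R L).[x]) /\
  1 <= x /\
  (x = 1 <-> k = 0%N /\ g%:R = N%:R / 2%:R :> R /\ t%:R = N%:R / 2%:R :> R).
Proof.
set r := Num.sqrt d%:R in hx *.
have r_gt0 : 0 < r by rewrite sqrtr_gt0 ltr0n.
have r_neq0 : r != 0 by rewrite gt_eqF.
have r2 : r * r = g%:R * t%:R by rewrite -expr2 sqr_sqrtr ?ler0n // hd natrM.
have Nx : N%:R = 2%:R * r * x by rewrite hx; field.
have NE : N%:R = g%:R + t%:R + k%:R :> R.
  by rewrite -hN (card_symtype ty) hg ht hk !natrD.
have g_ge0 : 0 <= g%:R :> R := ler0n R g.
have t_ge0 : 0 <= t%:R :> R := ler0n R t.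
have k_ge0 : 0 <= k%:R :> R := ler0n R k.
have amgm : 2%:R * r <= g%:R + t%:R.
  rewrite -ler_sqr ?nnegrE ?addr_ge0 ?mulr_ge0 ?(ltW r_gt0) //.
  (* The squares differ by (g + t)^2 - 4gt = (g - t)^2. *)
  by have := sqr_ge0 (g%:R - t%:R : R); rewrite !expr2; nra.
split; last split.
- move=> L; elim/ltn_ind: L => -[|[|L]] IH.
  + by rewrite num_cascade_freeE num_cascade_free_from0 hornerC mulr1.
  + rewrite num_cascade_freeE num_cascade_free_fromS !num_cascade_free_from0.
    rewrite !muln1 -card_symtype hN Nx hornerZ hornerX expr1; ring.
  + have /(congr1 (fun n => n%:R : R)) /= := num_cascade_free_rec ty L.
    (* With N = 2rx and gt = r^2, the counting recurrence is r^(L+2) times the Chebyshev one. *)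
    rewrite hg ht hN natrD !natrM (IH L) // (IH L.+1) // Nx -r2 chebyshevU_recE => /eqP.
    by rewrite -subr_eq0 => /eqP h; apply/eqP; rewrite -subr_eq0 -h !exprS; apply/eqP; ring.
- by rewrite hx ler_pdivlMr ?mul1r ?mulr_gt0 ?ltr0n //; lra.
split=> [x1|[k0 [gN tN]]].
(* Here g + t + k = N = 2r <= g + t, so k vanishes and AM-GM is an equality. *)
- have k0 : k%:R = 0 :> R by move: Nx; rewrite x1; lra.
  have gt : (g%:R - t%:R) ^+ 2 = 0 :> R.
    have gtr : g%:R + t%:R = 2%:R * r by move: Nx; rewrite x1; lra.
    have -> : (g%:R - t%:R) ^+ 2 = (g%:R + t%:R) ^+ 2 - 4%:R * (g%:R * t%:R) :> R by ring.
    by rewrite gtr -r2; ring.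
  move/eqP: gt; rewrite sqrf_eq0 subr_eq0 => /eqP gt.
  split; first by apply/eqP; rewrite -(eqr_nat R) k0.
  by split; lra.
(* Both sides are nonnegative with square gt; then N = 2rx reads r = rx, and r cancels. *)
- have rN : r = N%:R / 2%:R.
    apply/eqP; rewrite -(eqrXn2 (n := 2)) ?(ltW r_gt0) ?divr_ge0 ?ler0n //.
    by rewrite !expr2 r2 gN tN.
  by apply: (mulfI r_neq0); lra.
Qed.
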